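(* Let $\overline{A_1A_2A_3}$ be a triangle in the Euclidean plane $\mathbb{R}^2$ with quadrances $Q_1,Q_2,Q_3$ and spreads $s_1,s_2,s_3$. Then $$\left(Q_1-Q_2-Q_3\right)^{2}=4Q_2Q_3\left(1-s_1\right).$$
   Context: The quadrance between points $A=[x_1,y_1]$ and $B=[x_2,y_2]$ of the real Euclidean plane is $Q(A,B)=(x_2-x_1)^2+(y_2-y_1)^2$. The spread $s(l_1,l_2)$ between two lines $l_1,l_2$ is defined as follows. If $l_1$ and $l_2$ are parallel, $s(l_1,l_2)=0$. If they intersect at a point $A$, choose a point $B\neq A$ on $l_1$ and let $C$ be the foot of the perpendicular from $B$ to $l_2$; then $s(l_1,l_2)=Q(B,C)/Q(A,B)$, which is independent of the choice of $B$ (perpendicular lines have spread $1$). Equivalently, if the lines have equations $a_1x+b_1y+c_1=0$ and $a_2x+b_2y+c_2=0$, then $s(l_1,l_2)=\dfrac{(a_1b_2-a_2b_1)^2}{(a_1^2+b_1^2)(a_2^2+b_2^2)}$. A triangle $\overline{A_1A_2A_3}$ is given by three non-collinear points. Its quadrances are $Q_1=Q(A_2,A_3)$, $Q_2=Q(A_1,A_3)$, $Q_3=Q(A_1,A_2)$, and its spreads are $s_1=s(A_1A_2,A_1A_3)$, $s_2=s(A_2A_1,A_2A_3)$, $s_3=s(A_3A_1,A_3A_2)$, where $A_iA_j$ denotes the line through $A_i$ and $A_j$ (so $s_i$ is the spread at vertex $A_i$, opposite the side with quadrance $Q_i$). *)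

(* Defs.v *)
From mathcomp Require Import all_boot all_order all_algebra.
From mathcomp Require Import boolp classical_sets reals.
Set Implicit Arguments.
Unset Strict Implicit.
Unset Printing Implicit Defensive.
Import Order.TTheory GRing.Theory Num.Theory.
Local Open Scope classical_set_scope.
Local Open Scope ring_scope.

Definition quadrance (R : realType) (A B : R * R) : R :=
  (B.1 - A.1) ^+ 2 + (B.2 - A.2) ^+ 2.

(* Lines are point sets. This one is degenerate when a = b = 0, a case that
   [is_line] excludes. *)
Definition line_eq (R : realType) (a b c : R) : set (R * R) :=
  [set P | a * P.1 + b * P.2 + c = 0].

Definition is_line (R : realType) (l : set (R * R)) : Prop :=
  exists a b c : R, (a, b) <> (0, 0) /\ l = line_eq a b c.

Definition collinear (R : realType) (A B C : R * R) : Prop :=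
  exists l : set (R * R), [/\ is_line l, l A, l B & l C].

(* For A <> B, the line joining A and B; the whole plane if A = B. *)
Definition line_through (R : realType) (A B : R * R) : set (R * R) :=
  line_eq (A.2 - B.2) (B.1 - A.1) (A.1 * B.2 - A.2 * B.1).

(* For lines of the plane; a line is parallel to itself. *)
Definition parallel (R : realType) (l1 l2 : set (R * R)) : Prop :=
  l1 = l2 \/ l1 `&` l2 = set0.

Definition is_foot (R : realType) (B : R * R) (l : set (R * R)) (C : R * R) :
    Prop :=
  l C /\ forall D, l D ->
    (B.1 - C.1) * (D.1 - C.1) + (B.2 - C.2) * (D.2 - C.2) = 0.

Definition is_spread (R : realType) (l1 l2 : set (R * R)) (s : R) : Prop :=
  (parallel l1 l2 /\ s = 0) \/
  (~ parallel l1 l2 /\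
   exists A B C : R * R,
     [/\ l1 A /\ l2 A, l1 B, B <> A, is_foot B l2 C &
         s = quadrance B C / quadrance A B]).

(* [is_spread l1 l2] holds of exactly one value when l1 and l2 are lines; [xget]
   selects it. The default 0 is only reached for sets that are not lines. *)
Definition spread (R : realType) (l1 l2 : set (R * R)) : R :=
  xget 0 [set s | is_spread l1 l2 s].

(* Main.v *)
Require Import Defs.
From mathcomp Require Import all_boot all_order all_algebra.
From mathcomp Require Import boolp classical_sets reals.
From mathcomp Require Import ring.
Set Implicit Arguments.
Unset Strict Implicit.
Unset Printing Implicit Defensive.
Import Order.TTheory GRing.Theory Num.Theory.
Local Open Scope ring_scope.

(** Put u = A2 - A1 and v = A3 - A1. Then Q3 = |u|^2, Q2 = |v|^2, and expanding
    |v - u|^2 gives Q1 - Q2 - Q3 = - 2 (u . v). By Lagrange's identity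
    (u . v)^2 = |u|^2 |v|^2 - (u x v)^2, so the claim reduces to
    s1 = (u x v)^2 / (|u|^2 |v|^2), which is [spread_at_vertex].

    The spread is defined by a choice of points A, B, C and then by a choice of
    value, so that formula needs two facts: every admissible choice of points
    gives the same value ([is_spread_at_vertex]), and an admissible choice
    exists ([foot_exists]). For the first, let w = B - A1. Since C is the foot
    of the perpendicular from B, Q(B, C) |v|^2 = (v x w)^2 ([quadrance_foot]).
    Since w is parallel to u, replacing w by u scales (v x w)^2 and |w|^2 by the
    same factor ([cross_sq_parallel]), so Q(B, C) / |w|^2 does not depend on
    B. *)

Definition dot (R : realType) (u v : R * R) : R := u.1 * v.1 + u.2 * v.2.

Definition cross (R : realType) (u v : R * R) : R := u.1 * v.2 - u.2 * v.1.

Lemma quadrance_dot (R : realType) (A B : R * R) :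
  quadrance A B = dot (B - A) (B - A).
Proof. by rewrite /quadrance /dot !expr2. Qed.

Lemma lagrange (R : realType) (u v : R * R) :
  dot u u * dot v v = dot u v ^+ 2 + cross u v ^+ 2.
Proof. by rewrite /dot /cross; ring. Qed.

Lemma crossBr (R : realType) (u v w : R * R) :
  cross u (v - w) = cross u v - cross u w.
Proof. by rewrite /cross /=; ring. Qed.

Lemma dot_neq0 (R : realType) (u : R * R) : u != 0 -> dot u u != 0.
Proof.
apply: contra_neq; case: u => a b; rewrite /dot /= -!expr2 => /eqP.
by rewrite paddr_eq0 ?sqr_ge0 // !sqrf_eq0 => /andP[/eqP-> /eqP->].
Qed.

Lemma quadrance_neq0 (R : realType) (A B : R * R) :
  A <> B -> quadrance A B != 0.
Proof.
by move=> AB; rewrite quadrance_dot dot_neq0 // subr_eq0 eq_sym; apply/eqP.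
Qed.

(** The three vectors live in a plane, so they satisfy the linear relation
    (v x w) u - (v x u) w = (u x w) v; its right-hand side vanishes here, and
    the claim compares the squared lengths of the two remaining terms. *)
Lemma cross_sq_parallel (R : realType) (u v w : R * R) :
  cross u w = 0 -> cross v w ^+ 2 * dot u u = cross v u ^+ 2 * dot w w.
Proof.
move=> uw0; apply/eqP; rewrite -subr_eq0; apply/eqP.
transitivity (cross u w * (cross v w * dot v u + cross v u * dot v w)).
  by rewrite /dot /cross; ring.
by rewrite uw0 mul0r.
Qed.

(** Two independent linear forms vanish simultaneously only at the origin, so
    lines with independent directions meet in at most one point. *)
Lemma cross_eq0_unique (R : realType) (u v w : R * R) :
  cross u v != 0 -> cross u w = 0 -> cross v w = 0 -> w = 0.
Proof.
move=> uv0 uw0 vw0.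
have w1 : cross u v * w.1 = 0.
  transitivity (cross u w * v.1 - cross v w * u.1); first by rewrite /cross; ring.
  by rewrite uw0 vw0; ring.
have w2 : cross u v * w.2 = 0.
  transitivity (cross u w * v.2 - cross v w * u.2); first by rewrite /cross; ring.
  by rewrite uw0 vw0; ring.
move: w1 w2 => /eqP + /eqP; rewrite !mulf_eq0 (negPf uv0) /=.
by case: w {uw0 vw0} => a b /= /eqP-> /eqP->.
Qed.

Lemma line_throughE (R : realType) (A B P : R * R) :
  line_through A B P <-> cross (B - A) (P - A) = 0.
Proof.
rewrite /line_through /line_eq /=.
suff -> : (A.2 - B.2) * P.1 + (B.1 - A.1) * P.2 + (A.1 * B.2 - A.2 * B.1) =
          cross (B - A) (P - A) by [].
by rewrite /cross /=; ring.
Qed.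

Lemma line_throughl (R : realType) (A B : R * R) : line_through A B A.
Proof. by apply/line_throughE; rewrite /cross /=; ring. Qed.

Lemma line_throughr (R : realType) (A B : R * R) : line_through A B B.
Proof. by apply/line_throughE; rewrite /cross /=; ring. Qed.

Lemma is_line_through (R : realType) (A B : R * R) :
  A <> B -> is_line (line_through A B).
Proof.
move=> AB; exists (A.2 - B.2), (B.1 - A.1), (A.1 * B.2 - A.2 * B.1); split=> //.
case=> /subr0_eq e2 /subr0_eq e1; apply: AB.
by rewrite [A]surjective_pairing [B]surjective_pairing e1 e2.
Qed.

Lemma exists_line (R : realType) (A B : R * R) :
  exists l, [/\ is_line l, l A & l B].
Proof.
have [<-|/eqP AB] := eqVneq A B; last first.
  by exists (line_through A B); split;
    [exact: is_line_through|exact: line_throughl|exact: line_throughr].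
(* Any second point will do when the two given ones coincide. *)
exists (line_through A (A.1 + 1, A.2)); split; try exact: line_throughl.
apply: is_line_through => /(congr1 fst) /= /eqP.
by rewrite -subr_eq0 opprD addNKr oppr_eq0 oner_eq0.
Qed.

Lemma not_collinear_cross (R : realType) (A1 A2 A3 : R * R) :
  ~ collinear A1 A2 A3 -> cross (A2 - A1) (A3 - A1) != 0.
Proof.
move=> triangle; apply/eqP => c0; apply: triangle.
have [<-|/eqP A12] := eqVneq A1 A2.
  by have [l [? ? ?]] := exists_line A1 A3; exists l.
exists (line_through A1 A2); split.
- exact: is_line_through.
- exact: line_throughl.
- exact: line_throughr.
- exact/line_throughE.
Qed.

(** Twice the area of a triangle is base times height, with v the base and BC
    the height: BC is orthogonal to v, so Lagrange's identity for v and B - C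
    has no dot term, and v x (B - C) = v x (B - A) since C - A is parallel
    to v. *)
Lemma quadrance_foot (R : realType) (A D B C : R * R) :
  is_foot B (line_through A D) C ->
  quadrance B C * quadrance A D = cross (D - A) (B - A) ^+ 2.
Proof.
move=> [/line_throughE lC orth].
have oD := orth D (line_throughr A D); have oA := orth A (line_throughl A D).
have vBC0 : dot (D - A) (C - B) = 0.
  transitivity (((B.1 - C.1) * (A.1 - C.1) + (B.2 - C.2) * (A.2 - C.2)) -
                ((B.1 - C.1) * (D.1 - C.1) + (B.2 - C.2) * (D.2 - C.2))).
    by rewrite /dot /=; ring.
  by rewrite oD oA subr0.
rewrite mulrC !quadrance_dot lagrange vBC0 expr0n add0r.
have -> : C - B = (C - A) - (B - A) by rewrite opprB addrA subrK.
by rewrite crossBr lC sub0r sqrrN.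
Qed.

Lemma foot_exists (R : realType) (A D B : R * R) :
  A <> D -> exists C, is_foot B (line_through A D) C.
Proof.
move=> AD; have := quadrance_neq0 AD; rewrite quadrance_dot.
set v := D - A => v0.
(* The orthogonal projection of B on the line. *)
set t := dot v (B - A) / dot v v.
exists (A.1 + t * v.1, A.2 + t * v.2); split.
  by apply/line_throughE; rewrite -/v /cross /=; ring.
move=> P /line_throughE; rewrite -/v => lP /=.
have tv : t * dot v v = dot v (B - A) by rewrite /t divfK.
(* A vector P - A parallel to v only has a component along v, and B - C has
   none. *)
apply: (mulfI v0); rewrite mulr0.
transitivity ((dot v (P - A) - t * dot v v) * (dot v (B - A) - t * dot v v) +
   cross v (P - A) * (cross v (B - A))).
  by rewrite /dot /cross /=; ring.
by rewrite tv subrr mulr0 lP mul0r addr0.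
Qed.

Lemma not_parallel_at_vertex (R : realType) (A1 A2 A3 : R * R) :
  cross (A2 - A1) (A3 - A1) != 0 ->
  ~ parallel (line_through A1 A2) (line_through A1 A3).
Proof.
move=> c0 [l12|l12].
  have := line_throughr A1 A3; rewrite -l12 => /line_throughE /eqP.
  by rewrite (negPf c0).
suff : set0 A1 by [].
by rewrite -l12; split; exact: line_throughl.
Qed.

(** All witnesses give the same value: the common point is forced to be A1, and
    as B runs along A1A2 the height and the distance to A1 scale together. *)
Lemma is_spread_at_vertex (R : realType) (A1 A2 A3 : R * R) (s : R) :
  cross (A2 - A1) (A3 - A1) != 0 ->
  is_spread (line_through A1 A2) (line_through A1 A3) s ->
  s * (quadrance A1 A2 * quadrance A1 A3) =
    cross (A2 - A1) (A3 - A1) ^+ 2.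
Proof.
move=> c0 [[]|[_ [A [B [C [[lA2 lA3] lB BA ft ->]]]]]].
  by move=> /(not_parallel_at_vertex c0).
move/line_throughE: lA2 => lA2; move/line_throughE: lA3 => lA3.
have EA : A = A1 by apply/eqP; rewrite -subr_eq0 (cross_eq0_unique c0 lA2 lA3).
subst A; move/line_throughE: lB => lB.
have q0 : quadrance A1 B != 0 by apply: quadrance_neq0 => /esym.
apply: (mulIf q0).
transitivity ((quadrance B C * quadrance A1 A3) * quadrance A1 A2).
  by field.
rewrite (quadrance_foot ft) !quadrance_dot cross_sq_parallel //.
by congr (_ * _); rewrite /cross; ring.
Qed.

Lemma spread_at_vertex (R : realType) (A1 A2 A3 : R * R) :
  cross (A2 - A1) (A3 - A1) != 0 ->
  spread (line_through A1 A2) (line_through A1 A3) *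
    (quadrance A1 A2 * quadrance A1 A3) = cross (A2 - A1) (A3 - A1) ^+ 2.
Proof.
move=> c0; apply: is_spread_at_vertex => //.
have A12 : A2 <> A1.
  by move=> e; move: c0; rewrite e subrr /cross !mul0r subrr eqxx.
have A13 : A1 <> A3.
  by move=> e; move: c0; rewrite e subrr /cross !mulr0 subrr eqxx.
have [C ft] := foot_exists A2 A13.
(* The value attained at B = A2 shows that the choice operator does not fall
   back on its default. *)
apply: (@xgetI _ 0 [set s | is_spread _ _ s]%classic
  (quadrance A2 C / quadrance A1 A2)).
right; split; first exact: not_parallel_at_vertex.
exists A1, A2, C; split=> //; last exact: line_throughr.
by split; exact: line_throughl.
Qed.

Theorem theorem6 (R : realType) (A1 A2 A3 : R * R)
    (triangle : ~ collinear A1 A2 A3) :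
  let Q1 := quadrance A2 A3 in
  let Q2 := quadrance A1 A3 in
  let Q3 := quadrance A1 A2 in
  let s1 := spread (line_through A1 A2) (line_through A1 A3) in
  (Q1 - Q2 - Q3) ^+ 2 = 4 * Q2 * Q3 * (1 - s1).
Proof.
move=> Q1 Q2 Q3 s1.
have spreadE := spread_at_vertex (not_collinear_cross triangle).
have -> : Q1 - Q2 - Q3 = - 2 * dot (A2 - A1) (A3 - A1).
  by rewrite /Q1 /Q2 /Q3 /quadrance /dot /=; ring.
transitivity (4 * (Q3 * Q2 - s1 * (Q3 * Q2))); last by ring.
by rewrite [s1 * _]spreadE /Q2 /Q3 !quadrance_dot lagrange; ring.
Qed.
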